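(* Let $f,g_1,\ldots,g_m\in\mathcal V_r$, let $K=\{(x,\lambda)\in\mathbb R^n\times\mathbb R^r:g_i(x,\lambda)\ge0,\ i=1,\ldots,m\}$ be nonempty, and let $f_{\min}$ be the optimal value of minimizing $f$ over $K$. Let $d\ge d_{\min}$, put $d_K=\max\{1,d_1,\ldots,d_m\}$, and assume $d\ge d_K$. Let $\mathbf y=(y^0,\ldots,y^r)$ be an optimal solution of the moment relaxation $$f_d^*=\inf_{\mathbf y}\{\mathcal L_{\mathbf y}(f):\ y^0_0=1,\ M_d(y^0)\succeq0,\ M_{d-d_i}(g_i\mathbf y)\succeq0\ (i=1,\ldots,m)\}.$$ Suppose, in addition, that for some $C_1,\ldots,C_r>0$, $$-C_kM_d(y^0)\preceq M_d(y^k)\preceq C_kM_d(y^0),\qquad k=1,\ldots,r.$$ If $$\operatorname{rank}M_d(y^0)=\operatorname{rank}M_{d-d_K}(y^0)=s,$$ then $f_d^*=f_{\min}$. Moreover, there exist distinct points $(x^{(j)},\lambda^{(j)})\in K$ and positive weights $w_j$, $j=1,\ldots,s$, with $\sum_jw_j=1$, such that the finitely atomic measure $\rho=\sum_{j=1}^sw_j\delta_{(x^{(j)},\lambda^{(j)})}$ represents $\mathbf y$ and each $(x^{(j)},\lambda^{(j)})$ is a global minimizer of $f$ over $K$.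
   Context: Here $x=(x_1,\ldots,x_n)$, $\lambda=(\lambda_1,\ldots,\lambda_r)$. $\mathcal V_r=\{p_0(x)+\sum_{k=1}^r\lambda_k p_k(x): p_0,\ldots,p_r\in\mathbb R[x]\}$. For $p=p_0+\sum_k\lambda_kp_k\in\mathcal V_r$, $\deg_xp=\max_{0\le k\le r}\deg p_k$. Put $d_i=\lceil\deg_xg_i/2\rceil$ for $i=1,\ldots,m$ and $d_{\min}=\max\{\lceil\deg_xf/2\rceil,d_1,\ldots,d_m\}$. The variable $\mathbf y=(y^0,y^1,\ldots,y^r)$ consists of truncated real sequences $y^k=(y^k_\alpha)_{\alpha\in\mathbb N^n,|\alpha|\le2d}$. $\mathcal L_{\mathbf y}(p_0+\sum_{k=1}^r\lambda_kp_k)=\sum_{k=0}^r\sum_\alpha(p_k)_\alpha y^k_\alpha$ for $\deg_xp\le2d$, where $(p_k)_\alpha$ is the coefficient of $x^\alpha$ in $p_k$. Moment matrices: $M_t(y^k)=(y^k_{\alpha+\beta})_{|\alpha|,|\beta|\le t}$ for $t\le d$. Writing $g_i=g_{i0}+\sum_{k=1}^r\lambda_kg_{ik}$ with $g_{ik}=\sum_\gamma g_{ik,\gamma}x^\gamma$, the restricted localizing matrix is $M_{d-d_i}(g_i\mathbf y)=\big(\sum_{k=0}^r\sum_\gamma g_{ik,\gamma}y^k_{\alpha+\beta+\gamma}\big)_{|\alpha|,|\beta|\le d-d_i}$. A measure $\rho$ on $K$ represents $\mathbf y$ if $y^0_\alpha=\int x^\alpha\,d\rho$ and $y^k_\alpha=\int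 x^\alpha\lambda_k\,d\rho$ for all $|\alpha|\le2d$ and $k=1,\ldots,r$. The optimal value $f_{\min}$ is $\inf_{(x,\lambda)\in K}f(x,\lambda)$. *)

(* Defs.v *)
From HB Require Import structures.
From mathcomp Require Import all_boot all_order all_algebra.
From mathcomp Require Import all_classical all_reals all_analysis.
(* The notations of mpoly clash with those of mathcomp-analysis:
   mpoly n R stands for {mpoly R[n]}, multinom n for 'X_{1..n},
   bmultinom n b for 'X_{1..n < b} (multi-indices of degree < b),
   mcoeff a p for p@_a and mnm_add for the sum of multi-indices. *)
From mathcomp Require Import -(notations) mpoly.

Set Implicit Arguments.
Unset Strict Implicit.
Unset Printing Implicit Defensive.

Import Order.TTheory GRing.Theory Num.Theory.
Local Open Scope classical_set_scope.
Local Open Scope ring_scope.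

(* V_r: the polynomial p_0 + \sum_k lambda_k p_k is given by its (unique)
   coefficients p_0, ..., p_r in R[x]; index ord0 is the lambda-free part and
   lift ord0 k, for k : 'I_r, goes with lambda_k. *)
Definition Vpoly (R : realType) (n r : nat) : Type := 'I_r.+1 -> mpoly n R.

Definition xlpoint (R : realType) (n r : nat) : Type :=
  (n.-tuple R * r.-tuple R)%type.

Definition evalV (R : realType) (n r : nat) (p : Vpoly R n r)
    (z : xlpoint R n r) : R :=
  meval (tnth z.1) (p ord0) +
  \sum_(k < r) tnth z.2 k * meval (tnth z.1) (p (lift ord0 k)).

(* msize p is deg p + 1, and 0 for p = 0; hence deg 0 = 0 here. *)
Definition degx (R : realType) (n r : nat) (p : Vpoly R n r) : nat :=
  (\max_(k < r.+1) (msize (p k)).-1)%N.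

Definition half_degx (R : realType) (n r : nat) (p : Vpoly R n r) : nat :=
  uphalf (degx p).

Definition d_min (R : realType) (n r m : nat) (f : Vpoly R n r)
    (g : 'I_m -> Vpoly R n r) : nat :=
  maxn (half_degx f) (\max_(i < m) half_degx (g i))%N.

Definition d_K (R : realType) (n r m : nat) (g : 'I_m -> Vpoly R n r) : nat :=
  maxn 1 (\max_(i < m) half_degx (g i))%N.

Definition feasK (R : realType) (n r m : nat) (g : 'I_m -> Vpoly R n r) :
    set (xlpoint R n r) :=
  [set z | forall i, 0 <= evalV (g i) z].

Definition f_min (R : realType) (n r m : nat) (f : Vpoly R n r)
    (g : 'I_m -> Vpoly R n r) : \bar R :=
  ereal_inf [set (evalV f z)%:E | z in feasK g].

Definition tms (R : realType) (n d : nat) : Type :=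
  bmultinom n (2 * d).+1 -> R.

(* The entry u_a, with junk value 0 outside the range |a| <= 2d. *)
Definition mom (R : realType) (n d : nat) (u : tms R n d) (a : multinom n) : R :=
  if (insub a : option (bmultinom n (2 * d).+1)) is Some b then u b else 0.

Definition riesz (R : realType) (n r d : nat) (y : 'I_r.+1 -> tms R n d)
    (p : Vpoly R n r) : R :=
  \sum_(k < r.+1) \sum_(a <- msupp (p k)) mcoeff a (p k) * mom (y k) a.

Definition mon_idx (n t : nat) (i : 'I_#|{: bmultinom n t.+1}|) : multinom n :=
  bmnm (enum_val i).

Definition moment_mx (R : realType) (n d t : nat) (u : tms R n d) :
    'M[R]_#|{: bmultinom n t.+1}| :=
  \matrix_(i, j) mom u (mnm_add (mon_idx i) (mon_idx j)).

Definition localizing_mx (R : realType) (n r d t : nat) (g : Vpoly R n r)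
    (y : 'I_r.+1 -> tms R n d) : 'M[R]_#|{: bmultinom n t.+1}| :=
  \matrix_(i, j) \sum_(k < r.+1) \sum_(c <- msupp (g k))
    mcoeff c (g k) * mom (y k) (mnm_add (mnm_add (mon_idx i) (mon_idx j)) c).

Definition psdmx (R : realType) (N : nat) (A : 'M[R]_N) : Prop :=
  A^T = A /\ forall v : 'cV[R]_N, 0 <= (v^T *m A *m v) 0 0.

Definition loewner_le (R : realType) (N : nat) (A B : 'M[R]_N) : Prop :=
  psdmx (B - A).

Definition relax_feasible (R : realType) (n r m d : nat)
    (g : 'I_m -> Vpoly R n r) : set ('I_r.+1 -> tms R n d) :=
  [set y | [/\ mom (y ord0) (@mnm0 n) = 1,
               psdmx (moment_mx d (y ord0)) &
               forall i, psdmx (localizing_mx (d - half_degx (g i)) (g i) y)]].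
Arguments relax_feasible {R n r m} d g _.

Definition f_star (R : realType) (n r m d : nat) (f : Vpoly R n r)
    (g : 'I_m -> Vpoly R n r) : \bar R :=
  ereal_inf [set (riesz y f)%:E | y in relax_feasible d g].

Definition relax_optimal (R : realType) (n r m d : nat) (f : Vpoly R n r)
    (g : 'I_m -> Vpoly R n r) (y : 'I_r.+1 -> tms R n d) : Prop :=
  relax_feasible d g y /\ (riesz y f)%:E = f_star d f g.

Definition xmonom (R : realType) (n : nat) (a : multinom n)
    (x : n.-tuple R) : R :=
  \prod_(i < n) tnth x i ^+ a i.

Definition represents (R : realType) (n r d : nat) (K : set (xlpoint R n r))
    (rho : {measure set (n.-tuple R * r.-tuple R) -> \bar R})
    (y : 'I_r.+1 -> tms R n d) : Prop :=
  [/\ rho.-negligible (~` K),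
      forall a : bmultinom n (2 * d).+1,
        (\int[rho]_z (xmonom (bmnm a) z.1)%:E = (y ord0 a)%:E)%E &
      forall (k : 'I_r) (a : bmultinom n (2 * d).+1),
        (\int[rho]_z (xmonom (bmnm a) z.1 * tnth z.2 k)%:E
           = (y (lift ord0 k) a)%:E)%E].

Definition is_atomic (R : realType) (n r s : nat)
    (rho : {measure set (n.-tuple R * r.-tuple R) -> \bar R})
    (w : 'I_s -> R) (z : 'I_s -> xlpoint R n r) : Prop :=
  forall A : set (n.-tuple R * r.-tuple R), measurable A ->
    (rho A = \sum_(j < s) (w j)%:E * \d_(z j) A)%E.

Definition global_minimizer (R : realType) (n r m : nat) (f : Vpoly R n r)
    (g : 'I_m -> Vpoly R n r) (z : xlpoint R n r) : Prop :=
  feasK g z /\ forall z', feasK g z' -> evalV f z <= evalV f z'.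

(* Main.v *)
Require Import Defs.
From mathcomp Require Import all_boot all_order all_algebra.
From mathcomp Require Import all_classical all_reals all_analysis.
From mathcomp Require Import measurable_realfun.
From mathcomp Require Import -(notations) mpoly.
From mathcomp Require Import -(notations) complex.
From mathcomp Require Import ring lra zify.

(** Let H be the space of polynomials of degree at most d modulo the kernel of
    M_d(y^0), with the inner product induced by y^0.  By flatness H, of dimension
    s, is spanned by monomials of degree at most d - d_K < d, so multiplication
    by each x_l is a well-defined operator T_l on H.  The T_l are self-adjoint
    and commute, hence are simultaneously diagonalizable; the joint eigenvalues
    are the x-parts of the atoms, and expanding the class of 1 in the joint
    eigenbasis writes y^0 as an s-atomic functional, without extending the
    sequence.  The bounds put the kernel of M_d(y^0) inside that of M_d(y^k), so
    y^k is a symmetric form on H for which the T_l are still self-adjoint; as the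
    joint eigenvalues are distinct, it is diagonal in the same eigenbasis.
    Dividing its diagonal by that of y^0 gives the lambda_k of the atoms.
    Testing the localizing matrices on the interpolation polynomials of the
    atoms puts the atoms in K, and comparison with the moment sequences of Dirac
    measures gives optimality. *)

Set Implicit Arguments.
Unset Strict Implicit.
Unset Printing Implicit Defensive.

Import Order.TTheory GRing.Theory Num.Theory.
Local Open Scope classical_set_scope.
Local Open Scope ring_scope.

(** * Positive semidefinite and positive definite matrices *)

Lemma quad_ge0_lin_eq0 (R : realFieldType) (a b : R) :
  0 <= b -> (forall t, 0 <= 2 * t * a + t ^+ 2 * b) -> a = 0.
Proof.
move=> b_ge0 key; have b1 : 0 < b + 1 by lra.
(* Up to the 1 that keeps the denominator nonzero, this is the minimizer of the quadratic in [t];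
   the value there is negative unless [a = 0]. *)
have := key (- a / (b + 1)).
have -> : 2 * (- a / (b + 1)) * a + (- a / (b + 1)) ^+ 2 * b =
    - (a ^+ 2 * (b + 2) / (b + 1) ^+ 2) by field; lra.
rewrite oppr_ge0 pmulr_lle0 ?invr_gt0 ?exprn_gt0 // pmulr_lle0; last by lra.
by move=> h; apply/eqP; rewrite -sqrf_eq0 eq_le h sqr_ge0.
Qed.

(** Moving from [v] in the direction [w = A *m v] changes the form from 0 to
    [2 t |w|^2 + t^2 (w^T A w)]; this stays nonnegative for all [t] only if [w = 0]. *)
Lemma psd_quad_eq0 (R : realType) (N : nat) (A : 'M[R]_N) (v : 'cV[R]_N) :
  psdmx A -> (v^T *m A *m v) 0 0 = 0 -> A *m v = 0.
Proof.
move=> [AT Apsd] v0; pose w := A *m v.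
have wAv : (w^T *m A *m v) 0 0 = (w^T *m w) 0 0 by rewrite -mulmxA.
have vAw : (v^T *m A *m w) 0 0 = (w^T *m w) 0 0.
  by rewrite /w trmx_mul AT.
set b : R := (w^T *m A *m w) 0 0; set a : R := (w^T *m w) 0 0 in wAv vAw.
have key t : 0 <= 2 * t * a + t ^+ 2 * b.
  have := Apsd (v + t *: w).
  have -> : (v + t *: w)^T *m A *m (v + t *: w) =
     v^T *m A *m v + t *: (v^T *m A *m w) + t *: (w^T *m A *m v)
       + t ^+ 2 *: (w^T *m A *m w).
    have -> : (v + t *: w)^T = v^T + t *: w^T by rewrite !linearE.
    rewrite !mulmxDl !mulmxDr -!scalemxAl -!scalemxAr.
    by rewrite scalerA -expr2 !addrA.
  rewrite !mxE -/a -/b in v0 wAv vAw *.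
  by move: v0 wAv vAw; rewrite /b !mxE => -> -> ->; lra.
have b_ge0 : 0 <= b by apply: Apsd.
have /eqP := quad_ge0_lin_eq0 b_ge0 key.
rewrite /a mxE psumr_eq0; last first.
  by move=> i _; rewrite mxE -expr2 sqr_ge0.
move=> /allP h; apply/matrixP => i j; rewrite ord1.
have /implyP/(_ isT) := h i (mem_index_enum i).
by rewrite mxE -expr2 sqrf_eq0 => /eqP; rewrite /w => ->; rewrite mxE.
Qed.

(** Row vectors are used because the operators below act on rows from the right. *)
Definition posdefmx (R : realType) (N : nat) (B : 'M[R]_N) : Prop :=
  B^T = B /\ forall v : 'rV[R]_N, v != 0 -> 0 < (v *m B *m v^T) 0 0.

Lemma psd_unit_posdef (R : realType) (N : nat) (B : 'M[R]_N) :
  psdmx B -> B \in unitmx -> posdefmx B.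
Proof.
move=> Bpsd Bu; split=> [|v v0]; first by case: Bpsd.
have h : 0 <= (v *m B *m v^T) 0 0 by have := Bpsd.2 v^T; rewrite trmxK.
rewrite lt_neqAle h andbT eq_sym; apply: contra_neq v0 => h0.
have /(congr1 (mulmx (invmx B))) : B *m v^T = 0.
  by apply: psd_quad_eq0 => //; rewrite trmxK.
by rewrite mulKmx // mulmx0 => /(congr1 trmx); rewrite trmxK trmx0.
Qed.

Lemma posdef_ge0 (R : realType) (N : nat) (B : 'M[R]_N) (v : 'rV[R]_N) :
  posdefmx B -> 0 <= (v *m B *m v^T) 0 0.
Proof.
move=> [_ Bp]; have [->|/Bp/ltW//] := eqVneq v 0.
by rewrite !mul0mx mxE.
Qed.

(** * Operators self-adjoint for a positive definite form *)

Section SelfAdjoint.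
Context (R : realType) (N : nat) (B T : 'M[R]_N.+1).
Hypotheses (Bpos : posdefmx B) (Tadj : T *m B = B *m T^T).

Lemma selfadjoint_horner (p : {poly R}) :
  horner_mx T p *m B = B *m (horner_mx T p)^T.
Proof.
elim/poly_ind: p => [|p c IH]; first by rewrite rmorph0 trmx0 mul0mx mulmx0.
rewrite rmorphD rmorphM /= horner_mx_X horner_mx_C.
rewrite [(_ + _)^T]linearD /= tr_scalar_mx.
rewrite mulmxDl mulmxDr scalar_mxC -[_ * T]/(_ *m T) trmx_mul -mulmxA Tadj.
congr (_ + _); rewrite mulmxA IH -mulmxA; congr (_ *m _).
rewrite -!trmx_mul; congr (trmx _).
by apply/esym; exact: comm_horner_mx (comm_mx_refl T).
Qed.

(* For an eigenvector [x + i y], the two sides of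
   [x T B y^T = x B (y T)^T] differ by [Im a * (x B x^T + y B y^T)]. *)
Lemma selfadjoint_root_real (a : complex R) :
  root (map_poly (real_complex R) (mxminpoly T)) a -> complex.Im a = 0.
Proof.
rewrite -mxminpoly_map -eigenvalue_root_min => /eigenvalueP [v vT v0].
pose x := map_mx (@complex.Re R) v; pose y := map_mx (@complex.Im R) v.
have ReM (z : complex R) (t : R) :
    complex.Re (z * real_complex R t) = complex.Re z * t.
  by case: z => u w /=; rewrite mulr0 subr0.
have ImM (z : complex R) (t : R) :
    complex.Im (z * real_complex R t) = complex.Im z * t.
  by case: z => u w /=; rewrite mulr0 add0r.
have ReS (F : 'I_N.+1 -> complex R) :
    complex.Re (\sum_i F i) = \sum_i complex.Re (F i).
  by elim/big_rec2: _ => // i u [w1 w2] _ <- /=; case: (F i).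
have ImS (F : 'I_N.+1 -> complex R) :
    complex.Im (\sum_i F i) = \sum_i complex.Im (F i).
  by elim/big_rec2: _ => // i u [w1 w2] _ <- /=; case: (F i).
have xT : x *m T = complex.Re a *: x - complex.Im a *: y.
  apply/rowP => j; move/rowP/(_ j)/(congr1 (@complex.Re R)): vT.
  rewrite !mxE ReS; under eq_bigr do rewrite mxE ReM.
  under [X in _ -> X = _]eq_bigr do rewrite mxE.
  by move=> ->; case: (a) => ? ?; case: (v 0 j).
have yT : y *m T = complex.Re a *: y + complex.Im a *: x.
  apply/rowP => j; move/rowP/(_ j)/(congr1 (@complex.Im R)): vT.
  rewrite !mxE ImS; under eq_bigr do rewrite mxE ImM.
  under [X in _ -> X = _]eq_bigr do rewrite mxE.
  by move=> ->; case: (a) => ? ?; case: (v 0 j).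
have xy0 : (x != 0) || (y != 0).
  apply: contraR v0; rewrite negb_or !negbK => /andP[/eqP x0 /eqP y0].
  apply/eqP/rowP => j; move/rowP/(_ j): x0; move/rowP/(_ j): y0.
  by rewrite !mxE; case: (v 0 j) => ? ? /= -> ->.
have pos : 0 < (x *m B *m x^T) 0 0 + (y *m B *m y^T) 0 0.
  by case/orP: xy0 => /(Bpos.2 _) h; [rewrite ltr_pwDl|rewrite ltr_wpDl];
    rewrite ?posdef_ge0.
have : x *m T *m B *m y^T = x *m B *m (y *m T)^T.
  by rewrite trmx_mul -!mulmxA; congr (_ *m _); rewrite !mulmxA Tadj.
rewrite xT yT.
have -> : (complex.Re a *: y + complex.Im a *: x)^T =
    complex.Re a *: y^T + complex.Im a *: x^T by rewrite !linearE.
rewrite !mulmxBl !mulmxDr -!scalemxAl -!scalemxAr => /matrixP/(_ 0 0).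
move: pos; move: (x *m B *m x^T) (y *m B *m y^T) (x *m B *m y^T) => p q w pos.
rewrite !mxE => /addrI /eqP; rewrite eq_sym -addr_eq0 -mulrDr mulf_eq0.
by rewrite (gt_eqF pos) orbF => /eqP.
Qed.

(** If [S] is self-adjoint with [S^2 = 0], then [S B S^T = S S B = 0], so each row of [S] has length
    zero for [B] and vanishes. Each induction step halves the exponent. *)
Lemma selfadjoint_nilpotent (p : {poly R}) (k : nat) :
  horner_mx T (p ^+ (2 ^ k)) = 0 -> horner_mx T p = 0.
Proof.
elim: k => [//|k IH]; rewrite expnS mulnC exprM rmorphXn /= expr2 => S0.
apply: IH; set S := horner_mx T _ in S0 *.
have SB : S *m B *m S^T = 0.
  by rewrite -mulmxA -selfadjoint_horner mulmxA -[S *m S]/(S * S) S0 mul0mx.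
apply/row_matrixP => i; rewrite row0; apply: contraTeq isT => /(Bpos.2 _).
have -> : row i S *m B *m (row i S)^T = row i (col i (S *m B *m S^T)).
  by rewrite -!row_mul tr_row colE rowE; rewrite !rowE !colE !mulmxA.
by rewrite SB colE mul0mx rowE mulmx0 mxE ltxx.
Qed.

(** The minimal polynomial splits over the complex numbers, with real roots only, hence splits over
    [R]; it remains to make its roots simple. *)
Lemma selfadjoint_diagonalizable_succ : diagonalizable T.
Proof.
apply/diagonalizableP.
have [rs] := closed_field_poly_normal (map_poly (real_complex R) (mxminpoly T)).
rewrite (monicP (monic_map _ (mxminpoly_monic T))) scale1r => rsE.
have rsR : forall a, a \in rs -> a = real_complex R (complex.Re a).
  move=> a ars; have : complex.Im a = 0.
    by apply: selfadjoint_root_real; rewrite rsE root_prod_XsubC.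
  by case: (a) => u w /= ->.
pose us := map (@complex.Re R) rs.
have minE : mxminpoly T = \prod_(a <- us) ('X - a%:P).
  apply: (map_poly_inj (real_complex R)); rewrite rsE rmorph_prod /= big_map.
  rewrite big_seq [RHS]big_seq; apply: eq_bigr => a ars.
  by rewrite rmorphB /= map_polyX map_polyC /= -rsR.
(* The squarefree q with the same roots has a power killing T, and a nilpotent
   self-adjoint q(T) is zero. *)
exists (undup us); first exact: undup_uniq.
apply/mxminpoly_min/(@selfadjoint_nilpotent _ (size us))/mxminpoly_minP.
set q := \prod_(a <- undup us) _.
(* The minimal polynomial has [size us] linear factors, each dividing [q]; the exponent grows to
   [2 ^ size us] only to fit the nilpotency lemma. *)
apply: (@dvdp_trans _ (q ^+ size us)); last first.
  by rewrite dvdp_exp2l // ltnW // ltn_expl.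
have qdvd a : a \in us -> ('X - a%:P) %| q.
  by move=> aus; rewrite dvdp_XsubCl root_prod_XsubC mem_undup.
have {qdvd}: all (fun a => ('X - a%:P) %| q) us by apply/allP.
rewrite minE; elim: (us) => [|a ws IH] /=; first by rewrite big_nil dvd1p.
by case/andP=> aq wsq; rewrite big_cons exprS dvdp_mul // IH.
Qed.

End SelfAdjoint.

(** * Factoring a positive semidefinite matrix through a flat principal block *)

Lemma mxsub_sandwich (R : realType) (N p : nat) (h : 'I_p -> 'I_N)
    (M : 'M[R]_N) :
  mxsub h h M = rowsub h 1%:M *m M *m (rowsub h 1%:M)^T.
Proof.
by rewrite -rowsubE trmx_mxsub trmx1 mulmx_colsub mulmx1 -mxsubcr.
Qed.

Lemma psd_mxsub (R : realType) (N p : nat) (h : 'I_p -> 'I_N) (M : 'M[R]_N) :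
  psdmx M -> psdmx (mxsub h h M).
Proof.
move=> [MT Mp]; split=> [|v]; first by rewrite trmx_mxsub MT.
have := Mp ((rowsub h 1%:M)^T *m v).
by rewrite mxsub_sandwich trmx_mul trmxK !mulmxA.
Qed.

(** [psi] picks rows forming a basis of the row space of the small block; by equality of ranks the
    rows [phi] then span those of [M]. The rows of [X] are the coordinates in this basis, and a
    symmetric [M'] vanishing on the kernel of [M] obeys the same linear relations. *)
Lemma flat_factorization (R : realType) (N N0 s : nat) (M : 'M[R]_N)
    (h : 'I_N0 -> 'I_N) :
  psdmx M -> \rank M = s -> \rank (mxsub h h M) = s ->
  exists (psi : 'I_s -> 'I_N0) (X : 'M[R]_(N, s)),
    let phi := h \o psi in
    [/\ mxsub phi phi M \in unitmx, rowsub phi X = 1%:M &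
     forall M' : 'M[R]_N, M'^T = M' ->
       (forall v : 'cV_N, M *m v = 0 -> M' *m v = 0) ->
       M' = X *m mxsub phi phi M' *m X^T].
Proof.
move=> Mpsd rM rM0; have [MT _] := Mpsd.
set M0 := mxsub h h M in rM0; have M0T : M0^T = M0 by rewrite trmx_mxsub MT.
have [psi M0sub] : exists psi : 'I_s -> 'I_N0, (M0 <= rowsub psi M0)%MS.
  by case: s / rM0 {rM}; exists (maxrankfun M0); rewrite eq_maxrowsub.
exists psi.
pose phi := h \o psi; pose S : 'M[R]_(_, N) := rowsub phi 1%:M.
pose B := mxsub phi phi M.
have BE : B = mxsub psi psi M0 by rewrite /B -mxsub_comp.
have Bu : B \in unitmx.
  rewrite -row_full_unit /row_full eqn_leq rank_leq_row /=.
  have /submxP[Z M0E] := M0sub; rewrite -{1}rM0.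
  have -> : M0 = Z *m B *m Z^T.
    have h1 : M0 = (rowsub psi M0)^T *m Z^T by rewrite -trmx_mul -M0E M0T.
    rewrite {1}M0E {1}h1 trmx_mxsub M0T -mul_rowsub_mx -mxsubrc -BE.
    by rewrite mulmxA.
  by apply: leq_trans (mxrankM_maxl _ _) (mxrankM_maxr _ _).
have rSM : (s <= \rank (rowsub phi M))%N.
  apply: (@leq_trans (\rank B)); first by rewrite (mxrank_unit Bu).
  have -> : B = rowsub phi M *m S^T by rewrite /B mxsub_sandwich -rowsubE.
  exact: mxrankM_maxl.
have SMfree : row_free (rowsub phi M) by rewrite /row_free eqn_leq rank_leq_row.
have Msub : (M <= rowsub phi M)%MS.
  by rewrite -(geq_leqif (mxrank_leqif_sup (rowsub_sub phi M))) rM.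
have /submxP[X MX] := Msub.
exists X; split.
- exact: Bu.
- apply: (row_free_inj SMfree); rewrite mul1mx.
  by rewrite mul_rowsub_mx -MX.
move=> M' M'T ker.
(* The columns of [1 - S^T *m X^T] lie in the kernel of [M], hence in that of [M']. *)
have M'E : M' = M' *m S^T *m X^T.
  apply/eqP; rewrite -subr_eq0 -{1}[M']mulmx1 -mulmxA -mulmxBr; apply/eqP.
  apply/trmx_inj/row_matrixP => j; rewrite trmx0 row0 -tr_col.
  rewrite colE -mulmxA ker ?trmx0 // mulmxA mulmxBr mulmx1.
  have -> : M *m (S^T *m X^T) = M.
    by rewrite -{1}MT -!trmx_mul -mulmxA -rowsubE -MX MT.
  by rewrite subrr mul0mx.
rewrite mxsub_sandwich -/S.
rewrite [LHS]M'E -{1}M'T {1}M'E !trmx_mul !trmxK M'T !mulmxA.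
by [].
Qed.

Lemma selfadjoint_diagonalizable (R : realType) (s : nat) (B T : 'M[R]_s) :
  posdefmx B -> T *m B = B *m T^T -> diagonalizable T.
Proof.
case: s B T => [|s] B T Bp TB; first
  by rewrite (flatmx0 T); exact: diagonalizable0.
exact: selfadjoint_diagonalizable_succ Bp TB.
Qed.

(** * Multi-indices, monomials and moment matrices *)

Lemma multinom_ind (n : nat) (P : multinom n -> Prop) :
  P (@mnm0 n) -> (forall a l, P a -> P (mnm_add a (mnm1 l))) -> forall a, P a.
Proof.
move=> P0 PS a; have [k] := ubnP (mdeg a).
elim: k a => // k IH a; have [/eqP|a0] := eqVneq a (@mnm0 n).
  by move=> /eqP->.
have [l al] : exists l, a l != 0%N.
  apply/existsP; apply: contraNT a0; rewrite negb_exists => /forallP a0.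
  by apply/eqP/mnmP => i; rewrite mnm0E; apply/eqP; have := a0 i; rewrite negbK.
have aE : a = mnm_add (mnm_sub a (mnm1 l)) (mnm1 l) by rewrite submK // lep1mP.
by rewrite aE mdegD mdeg1 addn1 ltnS => /IH/PS.
Qed.

Lemma xmonom0 (R : realType) (n : nat) (x : n.-tuple R) :
  xmonom (@mnm0 n) x = 1.
Proof. by rewrite /xmonom big1 // => i _; rewrite mnm0E. Qed.

Lemma xmonomD (R : realType) (n : nat) (a b : multinom n) (x : n.-tuple R) :
  xmonom (mnm_add a b) x = xmonom a x * xmonom b x.
Proof.
by rewrite /xmonom -big_split; apply: eq_bigr => i _; rewrite mnmDE exprD.
Qed.

Lemma xmonom1 (R : realType) (n : nat) (l : 'I_n) (x : n.-tuple R) :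
  xmonom (mnm1 l) x = tnth x l.
Proof.
rewrite /xmonom (bigD1 l) //= mnm1E eqxx big1 ?mulr1 // => i il.
by rewrite mnm1E eq_sym (negPf il).
Qed.

(** With [p = q = d], every moment of degree at most [2 * d] becomes an entry of the moment
    matrix. *)
Lemma multinom_split (n p q : nat) (a : multinom n) : (mdeg a <= p + q)%N ->
  exists b c, [/\ a = mnm_add b c, (mdeg b <= p)%N & (mdeg c <= q)%N].
Proof.
elim/multinom_ind: a => [_|a l IH].
  by exists (@mnm0 n), (@mnm0 n); rewrite add0m mdeg0.
rewrite mdegD mdeg1 addn1 => h; have [|b [c [aE bp cq]]] := IH; first lia.
rewrite {}aE in h *.
have [bp'|pb] := ltnP (mdeg b) p.
  exists (mnm_add b (mnm1 l)), c; split=> //; last by rewrite mdegD mdeg1 addn1.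
  by rewrite -!addmA (addmC c).
exists b, (mnm_add c (mnm1 l)); split=> //; first by rewrite addmA.
by rewrite mdegD mdeg1; move: h; rewrite mdegD; lia.
Qed.

(* The index of the zero multi-index when [mdeg a > t]. *)
Definition mon_rank (n t : nat) (a : multinom n) : 'I_#|{: bmultinom n t.+1}| :=
  enum_rank (insubd (@bm0 n t) a).

Lemma mon_rankK (n t : nat) (a : multinom n) :
  (mdeg a <= t)%N -> mon_idx (mon_rank t a) = a.
Proof. by move=> h; rewrite /mon_idx enum_rankK insubdK. Qed.

Lemma mdeg_mon_idx (n t : nat) (i : 'I_#|{: bmultinom n t.+1}|) :
  (mdeg (mon_idx i) <= t)%N.
Proof. by rewrite -ltnS bmdeg. Qed.

Lemma moment_mxE (R : realType) (n d : nat) (u : tms R n d) (a b : multinom n) :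
  (mdeg a <= d)%N -> (mdeg b <= d)%N ->
  moment_mx d u (mon_rank d a) (mon_rank d b) = mom u (mnm_add a b).
Proof. by move=> ad bd; rewrite mxE !mon_rankK. Qed.

Lemma moment_mx_sub (R : realType) (n d t : nat) (u : tms R n d) :
  (t <= d)%N ->
  moment_mx t u =
  mxsub (mon_rank d \o @mon_idx n t) (mon_rank d \o @mon_idx n t)
    (moment_mx d u).
Proof.
move=> td; apply/matrixP => i j; rewrite [RHS]mxE.
by rewrite moment_mxE ?(leq_trans (mdeg_mon_idx _)) // mxE.
Qed.

Lemma trmx_moment_mx (R : realType) (n d t : nat) (u : tms R n d) :
  (moment_mx t u)^T = moment_mx t u.
Proof. by apply/matrixP => i j; rewrite !mxE addmC. Qed.

(** * Multiplication operators and extraction of the atoms *)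

Section FlatExtension.
Context (R : realType) (n r d t s : nat) (y : 'I_r.+1 -> tms R n d).
Local Notation M k := (moment_mx d (y k)).
Context (psi : 'I_s -> 'I_#|{: bmultinom n t.+1}|)
        (X : 'M[R]_(#|{: bmultinom n d.+1}|, s)).
Local Notation rk := (@mon_rank n d).
Local Notation base := (fun i : 'I_s => mon_idx (psi i)).
Local Notation phi := (rk \o base).
Local Notation B k := (mxsub phi phi (M k)).
Hypotheses (td : (t < d)%N) (Mpsd : psdmx (M ord0)) (Bu : B ord0 \in unitmx).
Hypotheses (Xphi : rowsub phi X = 1%:M)
  (ME : forall k, M k = X *m B k *m X^T).

Let step (l : 'I_n) (i : 'I_s) := mnm_add (base i) (mnm1 l).
(** Multiplication by [x_l] on H, acting on rows: row [i] holds the coordinates of [x_l] times the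
    basis monomial [base i], whose degree is at most [t + 1 <= d]. *)
Let T (l : 'I_n) : 'M[R]_s := rowsub (rk \o step l) X.

Let Bpos : posdefmx (B ord0).
Proof. by apply: psd_unit_posdef => //; apply: psd_mxsub. Qed.

Let Bfree : row_free (B ord0). Proof. by rewrite row_free_unit. Qed.

Let degb i : (mdeg (base i) <= t)%N. Proof. exact: mdeg_mon_idx. Qed.

Let degs l i : (mdeg (step l i) <= d)%N.
Proof. by rewrite /step mdegD mdeg1; have := degb i; lia. Qed.

(** [B k] is the Gram matrix of the form of [y k] on the basis. This turns the operator identities
    below into equalities of sums of multi-indices. *)
Let gram (p q : nat) (a : 'I_p -> multinom n) (b : 'I_q -> multinom n) k :
  (forall i, (mdeg (a i) <= d)%N) -> (forall i, (mdeg (b i) <= d)%N) ->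
  rowsub (rk \o a) X *m B k *m (rowsub (rk \o b) X)^T =
  \matrix_(i, j) mom (y k) (mnm_add (a i) (b j)).
Proof.
move=> ad bd; rewrite trmx_mxsub !mul_rowsub_mx mulmx_colsub -mxsubrc -?ME.
by apply/matrixP => i j; rewrite [RHS]mxE -moment_mxE // mxE.
Qed.

Let T_adj l k : T l *m B k = B k *m (T l)^T.
Proof.
have degb' i : (mdeg (base i) <= d)%N by have := degb i; lia.
have := gram k (degs l) degb'; have := gram k degb' (degs l).
rewrite Xphi trmx1 mulmx1 mul1mx => -> ->.
by apply/matrixP => i j; rewrite !mxE /step -!addmA (addmC (mnm1 l)).
Qed.

(** Moving one factor across [B ord0] leaves [T l *m B ord0 *m (T l')^T], whose entries have degree
    at most [2 * d] and are symmetric in [l] and [l']. *)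
Let T_comm l l' : comm_mx (T l) (T l').
Proof.
rewrite /comm_mx; apply: (row_free_inj Bfree).
rewrite -!mulmxA !T_adj !mulmxA !gram //.
apply/matrixP => i j; rewrite !mxE /step; congr (mom _ _).
by apply/mnmP => q; rewrite !mnmDE; lia.
Qed.

(** [T l] is multiplication by [x_l] on all monomials of degree less than [d], not only on the
    basis: both sides have the same pairings with the basis, and [B ord0] is nonsingular. *)
Let X_step a l : (mdeg a < d)%N ->
  row (rk (mnm_add a (mnm1 l))) X = row (rk a) X *m T l.
Proof.
move=> ad; have degb' i : (mdeg (base i) <= d)%N by have := degb i; lia.
have ad1 : (mdeg (mnm_add a (mnm1 l)) <= d)%N by rewrite mdegD mdeg1; lia.
apply: (row_free_inj Bfree).
have := gram ord0 (fun _ : 'I_1 => ad1) degb'.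
rewrite Xphi trmx1 mulmx1 => ->.
rewrite -mulmxA T_adj mulmxA.
rewrite [RHS](gram ord0 (fun _ : 'I_1 => ltnW ad) (degs l)).
by apply/matrixP => i j; rewrite !mxE /step -!addmA (addmC (mnm1 l)).
Qed.

(** The rows of [E] are the coefficients of interpolation polynomials of the atoms; they give
    distinctness of the atoms here and their feasibility later. *)
Lemma atoms_of_factorization :
  exists (x : 'I_s -> n.-tuple R) (W : 'I_r.+1 -> 'I_s -> R) (E : 'M[R]_s),
  [/\ forall j, 0 < W ord0 j,
    forall k a, (mdeg a <= 2 * d)%N ->
      mom (y k) a = \sum_j W k j * xmonom a (x j) &
    forall j j', \sum_i E j i * xmonom (base i) (x j') = (j == j')%:R].
Proof.
have degb' i : (mdeg (base i) <= d)%N by have := degb i; lia.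
have : codiagonalizable [seq T l | l <- enum 'I_n].
  apply/codiagonalizableP; split.
    by move=> _ _ /mapP[l _ ->] /mapP[l' _ ->].
  move=> _ /mapP[l _ ->].
  by apply: selfadjoint_diagonalizable Bpos (T_adj l ord0).
case=> P Pu /allP Pdiag.
have [dg PT] : exists dg : 'I_n -> 'rV[R]_s,
    forall l, P *m T l = diag_mx (dg l) *m P.
  exists (fun l => \row_j (P *m T l *m invmx P) j j) => l.
  have Tdiag : is_diag_mx (P *m T l *m invmx P).
    have /Pdiag /= : T l \in [seq T l | l <- enum 'I_n].
      by rewrite map_f ?mem_enum.
    by rewrite /similar_to conjumx.
  set D := P *m T l *m invmx P in Tdiag *.
  have -> : diag_mx (\row_j D j j) = D.
    apply/matrixP => i j; rewrite [LHS]mxE [X in X *+ _]mxE.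
    have [->|ij] := eqVneq i j; first by rewrite mulr1n.
    by rewrite mulr0n; apply/esym/(is_diag_mxP Tdiag).
  by rewrite mulmxKV.
have TP l : T l *m invmx P = invmx P *m diag_mx (dg l).
  by rewrite -[T l](mulKmx Pu) PT mulmxA mulmxK.
(* Row [j] of [P] is a joint eigenvector; its eigenvalues are the coordinates of the atom. *)
pose x j : n.-tuple R := [tuple dg l 0 j | l < n].
(* [Y] holds coordinates in the joint eigenbasis, and [c] those of the class of 1. *)
pose Y := X *m invmx P; pose c j := Y (rk (@mnm0 n)) j.
have YE a j : (mdeg a <= d)%N -> Y (rk a) j = c j * xmonom a (x j).
  elim/multinom_ind: a => [_|a l IH]; first by rewrite xmonom0 mulr1.
  rewrite mdegD mdeg1 addn1 => ad.
  have : row (rk (mnm_add a (mnm1 l))) Y = row (rk a) Y *m diag_mx (dg l).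
    by rewrite !row_mul X_step // -!mulmxA TP.
  move=> /rowP/(_ j); rewrite mul_mx_diag [LHS]mxE [RHS]mxE => ->.
  rewrite [row _ _ _ _]mxE IH 1?ltnW //.
  by rewrite xmonomD xmonom1 tnth_mktuple mulrA.
(* The Gram matrix of the form of [y k] in the joint eigenbasis. *)
pose G k := P *m B k *m P^T.
have MG k : M k = Y *m G k *m Y^T.
  rewrite {1}ME /Y /G trmx_mul !mulmxA mulmxKV // -(mulmxA _ P^T).
  by rewrite -trmx_mul mulVmx // trmx1 mulmx1.
have GD k l : diag_mx (dg l) *m G k = G k *m diag_mx (dg l).
  rewrite /G !mulmxA -PT -[P *m T l *m _]mulmxA T_adj -!mulmxA.
  congr (_ *m (_ *m _)).
  by rewrite -trmx_mul PT trmx_mul tr_diag_mx.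
(* This is [P *m invmx P = 1], because [X] is the identity on the basis rows. *)
have PZ j j' : \sum_i P j i * (c j' * xmonom (base i) (x j')) = (j == j')%:R.
  have : (P *m rowsub phi Y) j j' = (j == j')%:R.
    by rewrite -mul_rowsub_mx Xphi mul1mx mulmxV // mxE.
  by rewrite mxE => <-; apply: eq_bigr => i _; rewrite mxE YE.
have c0 j : c j != 0.
  apply/eqP => cj; have := PZ j j; rewrite eqxx big1 => [/eqP|i _].
    by rewrite eq_sym oner_eq0.
  by rewrite cj mul0r mulr0.
pose E : 'M[R]_s := \matrix_(j, i) (c j * P j i).
have EE j j' : \sum_i E j i * xmonom (base i) (x j') = (j == j')%:R.
  transitivity (c j * (c j')^-1 * (j == j')%:R).
    rewrite -PZ mulr_sumr; apply: eq_bigr => i _; rewrite mxE.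
    by field.
  have [->|_] := eqVneq j j'; last by rewrite mulr0.
  by rewrite mulfV // mulr1.
have x_inj : injective x.
  move=> j j' xjj; have := EE j j'; rewrite -xjj EE eqxx.
  by case: (eqVneq j j') => // _ /eqP; rewrite oner_eq0.
(* Eigenvectors with distinct joint eigenvalues are orthogonal for every [y k], since each [T l] is
   self-adjoint for all these forms. *)
have Gdiag k i j : i != j -> G k i j = 0.
  move=> ij; have [l lij] : exists l, dg l 0 i != dg l 0 j.
    apply/existsP; apply: contraNT ij; rewrite negb_exists => /forallP xE.
    apply/eqP/x_inj/eq_from_tnth => l; rewrite !tnth_mktuple.
    by apply/eqP; have := xE l; rewrite negbK.
  have /matrixP/(_ i j) := GD k l; rewrite mul_diag_mx mul_mx_diag.
  rewrite [LHS]mxE [RHS]mxE mulrC => /eqP.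
  rewrite -subr_eq0 -mulrBr mulf_eq0 subr_eq0 (negPf lij).
  by rewrite orbF => /eqP.
(* The weights come from expanding [M k = Y *m G k *m Y^T] with [G k] diagonal; each of the two
   factors [Y] contributes one [c j]. *)
exists x, (fun k j => c j ^+ 2 * G k j j), E; split=> //.
  move=> j; rewrite pmulr_rgt0 ?exprn_even_gt0 //=.
  have -> : G ord0 j j = (row j P *m B ord0 *m (row j P)^T) 0 0.
    by rewrite -row_mul tr_row colE mulmxA -row_mul -colE [RHS]mxE [RHS]mxE.
  apply: Bpos.2; apply/eqP => Pj0; have := congr1 (row j) (mulmxV Pu).
  rewrite row_mul Pj0 mul0mx => /rowP/(_ j)/eqP.
  by rewrite !mxE eqxx eq_sym oner_eq0.
move=> k a; rewrite mul2n -addnn => /multinom_split[a1 [a2 [-> a1d a2d]]].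
rewrite -moment_mxE // MG mxE; apply: eq_bigr => j _.
rewrite [Y^T _ _]mxE YE // [X in X * _]mxE (bigD1 j) //=.
rewrite big1 ?addr0; last first.
  by move=> i ij; rewrite Gdiag ?mulr0.
by rewrite YE // xmonomD; ring.
Qed.

End FlatExtension.

(** On the kernel of [M] the two bounds force the form of [A] to vanish; then the semidefinite
    matrix [A + c *: M] kills [v], and so does [A]. *)
Lemma loewner_ker (R : realType) (N : nat) (A M : 'M[R]_N) (c : R)
    (v : 'cV[R]_N) :
  loewner_le (- (c *: M)) A -> loewner_le A (c *: M) ->
  M *m v = 0 -> A *m v = 0.
Proof.
rewrite /loewner_le opprK => lo hi Mv.
have quadM (B : 'M[R]_N) :
    (v^T *m (B + c *: M) *m v) 0 0 = (v^T *m B *m v) 0 0.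
  rewrite mulmxDr mulmxDl -scalemxAr -scalemxAl -(mulmxA _ M) Mv.
  by rewrite mulmx0 scaler0 addr0.
have lo0 := lo.2 v; have hi0 := hi.2 v; rewrite quadM in lo0.
rewrite (addrC (c *: M)) quadM mulmxN mulNmx mxE oppr_ge0 in hi0.
have quad0 : (v^T *m A *m v) 0 0 = 0 by apply/eqP; rewrite eq_le hi0.
have := psd_quad_eq0 lo (etrans (quadM A) quad0).
by rewrite mulmxDl -scalemxAl Mv scaler0 addr0.
Qed.

Lemma flat_extension (R : realType) (n r d t s : nat)
    (y : 'I_r.+1 -> tms R n d) :
  (t < d)%N -> psdmx (moment_mx d (y ord0)) ->
  \rank (moment_mx d (y ord0)) = s -> \rank (moment_mx t (y ord0)) = s ->
  (forall k (v : 'cV_ _),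
     moment_mx d (y ord0) *m v = 0 -> moment_mx d (y k) *m v = 0) ->
  exists (x : 'I_s -> n.-tuple R) (W : 'I_r.+1 -> 'I_s -> R)
         (a : 'I_s -> multinom n) (E : 'M[R]_s),
  [/\ forall i, (mdeg (a i) <= t)%N,
    forall j, 0 < W ord0 j,
    forall k b, (mdeg b <= 2 * d)%N ->
      mom (y k) b = \sum_j W k j * xmonom b (x j) &
    forall j j', \sum_i E j i * xmonom (a i) (x j') = (j == j')%:R].
Proof.
move=> td Mpsd rd rt ker; rewrite (moment_mx_sub _ (ltnW td)) in rt.
have [psi [X [Bu Xphi ME]]] := flat_factorization Mpsd rd rt.
have [x [W [E [Wpos rep itp]]]] := @atoms_of_factorization _ _ _ _ _ _ y psi X
  td Mpsd Bu Xphi (fun k => ME _ (trmx_moment_mx _ _) (ker k)).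
exists x, W, (fun i => mon_idx (psi i)), E; split=> // i.
exact: mdeg_mon_idx.
Qed.

(** * Sequences represented by finitely many atoms *)

(* (1, lambda), indexed by the components of a Vpoly. *)
Definition homog (R : realType) (r : nat) (l : r.-tuple R) (k : 'I_r.+1) : R :=
  if unlift ord0 k is Some i then tnth l i else 1.

Lemma homog0 (R : realType) (r : nat) (l : r.-tuple R) : homog l ord0 = 1.
Proof. by rewrite /homog unlift_none. Qed.

Lemma homogS (R : realType) (r : nat) (l : r.-tuple R) i :
  homog l (lift ord0 i) = tnth l i.
Proof. by rewrite /homog liftK. Qed.

Lemma evalV_homog (R : realType) (n r : nat) (p : Vpoly R n r)
    (z : xlpoint R n r) :
  evalV p z = \sum_k homog z.2 k *
    \sum_(c <- msupp (p k)) mcoeff c (p k) * xmonom c z.1.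
Proof.
rewrite big_ord_recl homog0 mul1r -mevalE /evalV; congr (_ + _).
by apply: eq_bigr => i _; rewrite homogS mevalE.
Qed.

(** The moment conditions of [represents] for finitely many atoms, free of integrals and uniform in
    [k] through [homog]. *)
Definition atomic_rep (R : realType) (n r d s : nat) (y : 'I_r.+1 -> tms R n d)
    (w : 'I_s -> R) (z : 'I_s -> xlpoint R n r) : Prop :=
  forall k b, (mdeg b <= 2 * d)%N ->
    mom (y k) b = \sum_j w j * (homog (z j).2 k * xmonom b (z j).1).

Lemma mdeg_degx (R : realType) (n r : nat) (p : Vpoly R n r) k c :
  c \in msupp (p k) -> (mdeg c <= degx p)%N.
Proof.
move=> /msize_mdeg_lt h; apply: leq_trans (leq_bigmax k).
by move: h; case: (mmeasure _ _).
Qed.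

Lemma degx_half (R : realType) (n r : nat) (p : Vpoly R n r) :
  (degx p <= 2 * half_degx p)%N.
Proof. by rewrite /half_degx; lia. Qed.

Section AtomicRep.
Context (R : realType) (n r d s : nat) (y : 'I_r.+1 -> tms R n d).
Context (w : 'I_s -> R) (z : 'I_s -> xlpoint R n r).
Hypothesis yrep : atomic_rep y w z.

(** Serves the Riesz functional with [b = 0] and localizing matrices with [b] a sum of two row
    indices. The degree bound avoids the junk values of [mom]. *)
Lemma atomic_shift (p : Vpoly R n r) (b : multinom n) :
  (mdeg b + degx p <= 2 * d)%N ->
  \sum_(k < r.+1) \sum_(c <- msupp (p k))
     mcoeff c (p k) * mom (y k) (mnm_add b c)
  = \sum_j w j * evalV p (z j) * xmonom b (z j).1.
Proof.
move=> bd; under [RHS]eq_bigr do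
  rewrite evalV_homog mulr_sumr mulr_suml.
rewrite exchange_big; apply: eq_bigr => k _ /=.
under [RHS]eq_bigr do rewrite !mulr_sumr mulr_suml.
rewrite exchange_big /= big_seq [RHS]big_seq; apply: eq_bigr => c /mdeg_degx cd.
rewrite yrep ?mdegD; last by lia.
by rewrite mulr_sumr; apply: eq_bigr => j _; rewrite xmonomD; ring.
Qed.

Lemma riesz_atomic (p : Vpoly R n r) : (half_degx p <= d)%N ->
  riesz y p = \sum_j w j * evalV p (z j).
Proof.
move=> pd; transitivity (\sum_j w j * evalV p (z j) * xmonom (@mnm0 n) (z j).1).
  rewrite -atomic_shift; last by rewrite mdeg0; have := degx_half p; lia.
  by apply: eq_bigr => k _; apply: eq_bigr => c _; rewrite add0m.
by apply: eq_bigr => j _; rewrite xmonom0 mulr1.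
Qed.

Lemma localizing_atomic (p : Vpoly R n r) (t : nat) :
  (t + half_degx p <= d)%N ->
  localizing_mx t p y = \matrix_(i, i')
    \sum_j w j * evalV p (z j) *
      xmonom (mnm_add (mon_idx i) (mon_idx i')) (z j).1.
Proof.
move=> td; apply/matrixP => i i'; rewrite !mxE atomic_shift // mdegD.
have := degx_half p; have := mdeg_mon_idx i; have := mdeg_mon_idx i'; lia.
Qed.

Lemma moment_atomic k t : (t <= d)%N ->
  moment_mx t (y k) = \matrix_(i, i')
    \sum_j w j * homog (z j).2 k *
      xmonom (mnm_add (mon_idx i) (mon_idx i')) (z j).1.
Proof.
move=> td; apply/matrixP => i i'; rewrite !mxE yrep.
  by apply: eq_bigr => j _; rewrite mulrA.
by rewrite mdegD; have := mdeg_mon_idx i; have := mdeg_mon_idx i'; lia.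
Qed.

End AtomicRep.

(** Each atom contributes a rank-one matrix, so the form is a weighted sum of squared values of the
    polynomial with coefficients [v]. *)
Lemma gram_quad (R : realType) (n p s : nat) (a : 'I_p -> multinom n)
    (c : 'I_s -> R) (x : 'I_s -> n.-tuple R) (v : 'cV[R]_p) :
  (v^T *m (\matrix_(i, i') \sum_j c j * xmonom (mnm_add (a i) (a i')) (x j))
     *m v) 0 0 = \sum_j c j * (\sum_i v i 0 * xmonom (a i) (x j)) ^+ 2.
Proof.
rewrite mxE; under eq_bigr do rewrite mxE mulr_suml.
under [RHS]eq_bigr do rewrite expr2 mulr_suml mulr_sumr.
rewrite [RHS]exchange_big [LHS]exchange_big; apply: eq_bigr => i _ /=.
under [RHS]eq_bigr do rewrite !mulr_sumr.
rewrite [RHS]exchange_big /=; apply: eq_bigr => i' _.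
rewrite !mxE mulr_sumr mulr_suml; apply: eq_bigr => j _.
by rewrite xmonomD; ring.
Qed.

Lemma gram_psd (R : realType) (n p s : nat) (a : 'I_p -> multinom n)
    (c : 'I_s -> R) (x : 'I_s -> n.-tuple R) : (forall j, 0 <= c j) ->
  psdmx (\matrix_(i, i') \sum_j c j * xmonom (mnm_add (a i) (a i')) (x j)).
Proof.
move=> c0; split=> [|v]; first by apply/matrixP => i i'; rewrite !mxE addmC.
by rewrite gram_quad sumr_ge0 // => j _; rewrite mulr_ge0 ?sqr_ge0.
Qed.

(** Applied to Dirac measures at points of K, this bounds the relaxation value by the values of
    [f]. *)
Lemma atomic_feasible (R : realType) (n r m d s : nat) (g : 'I_m -> Vpoly R n r)
    (y : 'I_r.+1 -> tms R n d) (w : 'I_s -> R) (z : 'I_s -> xlpoint R n r) :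
  (forall i, half_degx (g i) <= d)%N -> atomic_rep y w z ->
  (forall j, 0 <= w j) -> \sum_j w j = 1 -> (forall j, feasK g (z j)) ->
  relax_feasible d g y.
Proof.
move=> gd yrep w0 w1 zK; split.
- rewrite yrep ?mdeg0 // -[RHS]w1; apply: eq_bigr => j _.
  by rewrite homog0 xmonom0 !mulr1.
- rewrite (moment_atomic yrep) //; apply: gram_psd => j.
  by rewrite homog0 mulr1.
- move=> i; rewrite (localizing_atomic yrep) ?subnK //; apply: gram_psd => j.
  by rewrite mulr_ge0 ?zK.
Qed.

Lemma dirac_rep (R : realType) (n r d : nat) (z0 : xlpoint R n r) :
  exists y : 'I_r.+1 -> tms R n d,
    atomic_rep y (fun _ : 'I_1 => 1) (fun _ : 'I_1 => z0).
Proof.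
exists (fun k b => homog z0.2 k * xmonom (bmnm b) z0.1) => k b bd.
by rewrite big_ord1 mul1r /mom insubT.
Qed.

(** At the interpolation polynomial of atom [j] the localizing form equals [w j * evalV p (z j)].
    The degree bound [t] makes this polynomial an admissible test vector. *)
Lemma atoms_feasible (R : realType) (n r d s t : nat) (p : Vpoly R n r)
    (y : 'I_r.+1 -> tms R n d) (w : 'I_s -> R) (z : 'I_s -> xlpoint R n r)
    (a : 'I_s -> multinom n) (E : 'M[R]_s) :
  atomic_rep y w z -> (forall j, 0 < w j) -> (t + half_degx p <= d)%N ->
  (forall i, mdeg (a i) <= t)%N ->
  (forall j j', \sum_i E j i * xmonom (a i) (z j').1 = (j == j')%:R) ->
  psdmx (localizing_mx (d - half_degx p) p y) -> forall j, 0 <= evalV p (z j).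
Proof.
move=> yrep w0 td ad itp; rewrite (localizing_atomic yrep); last first.
  by rewrite subnK; lia.
move=> /(psd_mxsub (fun i => mon_rank _ (a i)))[_ +] j => /(_ (row j E)^T).
have -> : mxsub (fun i => mon_rank (d - half_degx p) (a i))
    (fun i => mon_rank (d - half_degx p) (a i))
    (\matrix_(i, i') \sum_j w j * evalV p (z j) *
       xmonom (mnm_add (mon_idx i) (mon_idx i')) (z j).1) =
  \matrix_(i, i') \sum_j w j * evalV p (z j) *
     xmonom (mnm_add (a i) (a i')) (z j).1.
  have ad' i : (mdeg (a i) <= d - half_degx p)%N by have := ad i; lia.
  by apply/matrixP => i i'; rewrite !mxE !mon_rankK.
have itpj j' :
    \sum_i (row j E)^T i 0 * xmonom (a i) (z j').1 = (j == j')%:R.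
  by rewrite -itp; apply: eq_bigr => i _; rewrite !mxE.
rewrite gram_quad; under eq_bigr do rewrite itpj.
rewrite (bigD1 j) //= big1 ?addr0 => [|j' jj'].
  by rewrite eqxx expr1n mulr1 pmulr_rge0.
by rewrite eq_sym (negPf jj') expr0n mulr0.
Qed.

Lemma half_degx_dK (R : realType) (n r m : nat) (g : 'I_m -> Vpoly R n r) i :
  (half_degx (g i) <= d_K g)%N.
Proof. by rewrite /d_K leq_max (leq_bigmax i) orbT. Qed.

Lemma flat_atomic_rep (R : realType) (n r m d s : nat)
    (g : 'I_m -> Vpoly R n r) (y : 'I_r.+1 -> tms R n d) (C : 'I_r -> R) :
  (d_K g <= d)%N -> relax_feasible d g y ->
  (forall k : 'I_r,
     loewner_le (- (C k *: moment_mx d (y ord0)))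
                (moment_mx d (y (lift ord0 k))) /\
     loewner_le (moment_mx d (y (lift ord0 k)))
                (C k *: moment_mx d (y ord0))) ->
  \rank (moment_mx d (y ord0)) = s ->
  \rank (moment_mx (d - d_K g) (y ord0)) = s ->
  exists (z : 'I_s -> xlpoint R n r) (w : 'I_s -> R),
    [/\ injective z, forall j, feasK g (z j), forall j, 0 < w j,
        \sum_j w j = 1 & atomic_rep y w z].
Proof.
move=> dKd [y1 Mpsd Lpsd] bnd rd rt.
(* The 1 in [d_K] keeps the basis monomials in degree less than [d], leaving room to multiply by a
   variable. *)
have dK0 : (0 < d_K g)%N by rewrite /d_K leq_max.
have td : (d - d_K g < d)%N by lia.
have ker k (v : 'cV_ _) :
    moment_mx d (y ord0) *m v = 0 -> moment_mx d (y k) *m v = 0.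
  by case: (unliftP ord0 k) => [i ->|-> //]; apply: loewner_ker; apply bnd.
have [x [W [a [E [ad W0 rep itp]]]]] := flat_extension td Mpsd rd rt ker.
(* The lambda-coordinates are the densities of [y^k] relative to [y^0] at the atoms. *)
pose z j : xlpoint R n r := (x j, [tuple W (lift ord0 k) j / W ord0 j | k < r]).
have yrep : atomic_rep y (W ord0) z.
  move=> k b bd; rewrite rep //; apply: eq_bigr => j _.
  rewrite mulrA /z /=; case: (unliftP ord0 k) => [i ->|->].
    rewrite homogS tnth_mktuple (mulrC (W ord0 j)) divfK //.
    by rewrite gt_eqF.
  by rewrite homog0 mulr1.
exists z, (W ord0); split=> //.
- move=> j j' [xjj _]; have := itp j j'; rewrite -xjj itp eqxx.
  by case: (eqVneq j j') => // _ /eqP; rewrite oner_eq0.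
- move=> j i; apply: (atoms_feasible yrep W0 _ ad itp (Lpsd i)).
  by have := half_degx_dK g i; lia.
- rewrite -y1 yrep ?mdeg0 //; apply: eq_bigr => j _.
  by rewrite homog0 xmonom0 !mulr1.
Qed.

(** * Finitely atomic measures and measurability *)

Lemma finite_atomic_measure (R : realType) (disp : measure_display)
    (T : measurableType disp) (s : nat) (w : 'I_s -> R) (z : 'I_s -> T) :
  (forall j, 0 <= w j) ->
  exists rho : {measure set T -> \bar R},
    (forall A, rho A = \sum_(j < s) (w j)%:E * \d_(z j) A)%E /\
    (forall f : T -> R, measurable_fun setT f ->
       (\int[rho]_x (f x)%:E)%E = (\sum_j w j * f (z j))%:E).
Proof.
move=> w0.
(* [msum] takes a sequence indexed by [nat]; indices from [s] on get the zero measure. *)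
pose mu (k : nat) : {measure set T -> \bar R} :=
  if insub k is Some j then mscale (NngNum (w0 j)) (\d_(z j)) else mzero.
have muE (j : 'I_s) :
    mu j = mscale (NngNum (w0 j)) (\d_(z j)) :> {measure set T -> \bar R}.
  by rewrite /mu valK.
exists (msum mu s); split=> [A|f mf].
  by rewrite /= /msum; apply: eq_bigr => j _; rewrite muE.
have /measurable_EFinP mf' := mf.
have ge0_int (h : T -> \bar R) :
    measurable_fun setT h -> (forall x, 0 <= h x)%E ->
    (\int[msum mu s]_x h x = \sum_(j < s) (w j)%:E * h (z j))%E.
  move=> mh h0; rewrite ge0_integral_measure_sum //; apply: eq_bigr => j _.
  rewrite muE ge0_integral_mscale // integral_dirac // diracE in_setT mul1e.
  by [].
(* A function of arbitrary sign is split into positive and negative parts, each with a finite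
   integral. *)
rewrite integralE !ge0_int //; last 2 first.
  exact: measurable_funeneg.
  exact: measurable_funepos.
have posE j :
    ((w j)%:E * (fun x => (f x)%:E)^\+ (z j)
     = (w j * Num.max (f (z j)) 0)%:E)%E.
  by rewrite funeposE EFinM EFin_max.
have negE j :
    ((w j)%:E * (fun x => (f x)%:E)^\- (z j)
     = (w j * Num.max (- f (z j)) 0)%:E)%E.
  by rewrite funenegE EFinM EFin_max.
under eq_bigr do rewrite posE.
under [X in (_ - X)%E]eq_bigr do rewrite negE.
rewrite !sumEFin -EFinB -sumrB; congr EFin; apply: eq_bigr => j _.
rewrite -mulrBr; congr (_ * _).
by case: (lerP 0 (f (z j))) => h; case: (lerP 0 (- f (z j))) => h'; lra.
Qed.

Section Measurability.
Context (R : realType) (n r : nat).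

Lemma measurable_xmonom (a : multinom n) :
  measurable_fun setT (fun z : n.-tuple R * r.-tuple R => xmonom a z.1).
Proof.
apply: measurable_prod => i _; apply: measurable_funX.
by apply: measurableT_comp (measurable_tnth i) _.
Qed.

Lemma measurable_snd_tnth (k : 'I_r) :
  measurable_fun setT (fun z : n.-tuple R * r.-tuple R => tnth z.2 k).
Proof. by apply: measurableT_comp (measurable_tnth k) _. Qed.

Lemma measurable_evalV (p : Vpoly R n r) :
  measurable_fun setT (fun z : n.-tuple R * r.-tuple R => evalV p z).
Proof.
have mm q : measurable_fun setT
    (fun z : n.-tuple R * r.-tuple R => meval (tnth z.1) q).
  under eq_fun do rewrite mevalE.
  apply: measurable_sum => c; apply: measurable_funM => //.
  exact: measurable_xmonom.
apply: measurable_funD => //; apply: measurable_sum => k.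
by apply: measurable_funM => //; exact: measurable_snd_tnth.
Qed.

Lemma measurable_feasK m (g : 'I_m -> Vpoly R n r) :
  measurable (feasK g : set (n.-tuple R * r.-tuple R)).
Proof.
have -> : (feasK g : set (n.-tuple R * r.-tuple R)) =
    \bigcap_(i in [set: 'I_m]) ((fun z => evalV (g i) z) @^-1` `[0, +oo[).
  apply/seteqP; split => [z zK i _|z zK i] /=; first by rewrite in_itv /= zK.
  by have := zK i I; rewrite /= in_itv /= andbT.
apply: fin_bigcap_measurable => // i _.
by rewrite -[X in measurable X]setTI; apply: measurable_evalV.
Qed.

End Measurability.

(** * Exactness of the relaxation and global minimizers *)

Unset Implicit Arguments.

Theorem theorem5p3 (R : realType) (n r m d s : nat)
    (f : Vpoly R n r) (g : 'I_m -> Vpoly R n r)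
    (y : 'I_r.+1 -> tms R n d) (C : 'I_r -> R)
    (K_nonempty : feasK g !=set0)
    (d_ge_dmin : (d_min f g <= d)%N)
    (d_ge_dK : (d_K g <= d)%N)
    (y_optimal : relax_optimal f g y)
    (C_gt0 : forall k, 0 < C k)
    (y_bounds : forall k : 'I_r,
       loewner_le (- (C k *: moment_mx d (y ord0)))
                  (moment_mx d (y (lift ord0 k))) /\
       loewner_le (moment_mx d (y (lift ord0 k)))
                  (C k *: moment_mx d (y ord0)))
    (rank_d : \rank (moment_mx d (y ord0)) = s)
    (rank_flat : \rank (moment_mx (d - d_K g) (y ord0)) = s) :
  f_star d f g = f_min f g /\
  exists (z : 'I_s -> xlpoint R n r) (w : 'I_s -> R)
         (rho : {measure set (n.-tuple R * r.-tuple R) -> \bar R}),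
    [/\ injective z /\ (forall j, feasK g (z j)),
        (forall j, 0 < w j) /\ \sum_(j < s) w j = 1,
        is_atomic rho w z,
        represents (feasK g) rho y &
        forall j, global_minimizer f g (z j)].
Proof.
have [yfeas yopt] := y_optimal.
have fd : (half_degx f <= d)%N by apply: leq_trans d_ge_dmin; apply: leq_maxl.
have gd i : (half_degx (g i) <= d)%N.
  by apply: leq_trans d_ge_dK; apply: half_degx_dK.
have [z [w [z_inj zK w0 w1 yrep]]] :=
  flat_atomic_rep d_ge_dK yfeas y_bounds rank_d rank_flat.
(* The moment sequence of the Dirac measure at [z'] is feasible with value [evalV f z'], and [y] is
   optimal. *)
have lower z' : feasK g z' -> riesz y f <= evalV f z'.
  move=> z'K; have [y' y'rep] := @dirac_rep R n r d z'.
  rewrite -lee_fin yopt; have -> : evalV f z' = riesz y' f.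
    by rewrite (riesz_atomic y'rep) // big_ord1 mul1r.
  apply: ereal_inf_lbound; exists y' => //.
  by apply: (atomic_feasible gd y'rep) => //; rewrite big_ord1.
(* The gaps [evalV f (z i) - riesz y f] are nonnegative with weighted sum zero, so each vanishes. *)
have atom_val j : evalV f (z j) = riesz y f.
  apply/eqP; rewrite -subr_eq0.
  have gap0 i : 0 <= w i * (evalV f (z i) - riesz y f).
    by rewrite mulr_ge0 ?(ltW (w0 i)) // subr_ge0 lower.
  have : \sum_i w i * (evalV f (z i) - riesz y f) == 0.
    under eq_bigr do rewrite mulrBr.
    by rewrite sumrB -mulr_suml w1 mul1r -(riesz_atomic yrep) // subrr.
  rewrite psumr_eq0 // => /allP/(_ j (mem_index_enum j)) /=.
  by rewrite mulf_eq0 gt_eqF.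
split.
  apply/eqP; rewrite eq_le -yopt; apply/andP; split.
    by apply: le_ereal_inf_tmp => _ [z' z'K <-]; rewrite lee_fin lower.
  (* Total mass one forces [s > 0]; any atom then attains the relaxation value inside K. *)
  have [j _] : exists j : 'I_s, true.
    case: (posnP s) => [s0|s0]; last by exists (Ordinal s0).
    move: w1; rewrite big1 => [/eqP|[j jlt] _]; last by lia.
    by rewrite eq_sym oner_eq0.
  by rewrite -(atom_val j); apply: ereal_inf_lbound; exists (z j).
have [rho [rhoA rhoI]] := finite_atomic_measure z (fun j => ltW (w0 j)).
exists z, w, rho; split=> //.
  split.
  - exists (~` feasK g); split=> //.
      by apply: measurableC; exact: measurable_feasK.
    rewrite rhoA big1 // => j _.
    by rewrite diracE memNset ?mule0 // => /(_ (zK j)).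
  - move=> a; have -> : y ord0 a = mom (y ord0) (bmnm a) by rewrite /mom valK.
    rewrite rhoI ?yrep //; last exact: measurable_xmonom.
      by congr EFin; apply: eq_bigr => j _; rewrite homog0 mul1r.
    by rewrite -ltnS bmdeg.
  - move=> k a.
    have -> : y (lift ord0 k) a = mom (y (lift ord0 k)) (bmnm a).
      by rewrite /mom valK.
    rewrite rhoI ?yrep //.
    + by congr EFin; apply: eq_bigr => j _; rewrite homogS (mulrC (xmonom _ _)).
    + by rewrite -ltnS bmdeg.
    + apply: measurable_funM; first exact: measurable_xmonom.
      exact: measurable_snd_tnth.
by move=> j; split=> // z' z'K; rewrite atom_val lower.
Qed.
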